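(* For every positive integer $k$, $$G^P_k(q;a,b,c,d)=\left(1-bq^{k+1}\right)\sum_{j=0}^{k+1}\frac{u_j(a,b,c,d)\,q^{\binom{k+1-j}{2}}}{(q;q)_{k+1-j}},$$ where for all $n\ge 0$ $$u_{2n}(a,b,c,d)=(1-b)\sum_{\ell=0}^{n}\frac{(-aq^{2\ell+1};q^2)_{n-\ell}(-dq^{2\ell+1};q^2)_{n-\ell}}{(bq^{2\ell};q^2)_{n-\ell+1}(cq^{2\ell+1};q^2)_{n-\ell}}\frac{q^{2\ell}}{(q;q)_{2\ell}},$$ $$u_{2n+1}(a,b,c,d)=(b-1)\sum_{\ell=0}^{n}\frac{(-aq^{2\ell+2};q^2)_{n-\ell}(-dq^{2\ell+2};q^2)_{n-\ell}}{(bq^{2\ell+1};q^2)_{n-\ell+1}(cq^{2\ell+2};q^2)_{n-\ell}}\frac{q^{2\ell+1}}{(q;q)_{2\ell+1}}.$$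
   Context: $(x;q)_n=\prod_{i=0}^{n-1}(1-xq^i)$. A coloured integer $m_x$ is a positive integer $m$ (its value) with a colour $x\in\{a,b,c,d\}$, totally ordered by $1_a<1_b<1_c<1_d<2_a<2_b<2_c<2_d<\cdots$. Let $\mathcal{P}$ be the set of finite non-increasing (in this order, possibly empty) sequences of coloured integers such that consecutive parts $m_x$ (larger) and $m'_y$ (next) satisfy $m-m'\ge P(x,y)$, where $P(a,a)=2,P(a,b)=1,P(a,c)=2,P(a,d)=2$; $P(b,a)=1,P(b,b)=0,P(b,c)=1,P(b,d)=1$; $P(c,a)=0,P(c,b)=1,P(c,c)=0,P(c,d)=2$; $P(d,a)=0,P(d,b)=1,P(d,c)=0,P(d,d)=2$. $G^P_k(q;a,b,c,d)=\sum_\lambda q^{|\lambda|}a^{\#_a}b^{\#_b}c^{\#_c}d^{\#_d}$ over $\lambda\in\mathcal{P}$ whose parts all have value $\le k$, where $|\lambda|$ is the sum of values and $\#_x$ the number of parts of colour $x$. The identity is one of rational functions / formal power series in $q$. *)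

(* Defs.v *)
From HB Require Import structures.
From mathcomp Require Import all_boot all_order all_algebra.
From mathcomp Require Import boolp classical_sets functions cardinality fsbigop.
From mathcomp Require Import mpoly.

Set Implicit Arguments.
Unset Strict Implicit.
Unset Printing Implicit Defensive.

Import GRing.Theory.
Local Open Scope ring_scope.

Section Fps.
Variable R : comNzRingType.

(* Formal power series \sum_n (f n) q^n in one variable q over R. *)
Record fps := FPS { coefps :> nat -> R }.

HB.instance Definition _ := gen_eqMixin fps.
HB.instance Definition _ := gen_choiceMixin fps.

Lemma fpsP (f g : fps) : (forall n, f n = g n) -> f = g.
Proof. by case: f g => [f] [g] /= /funext ->. Qed.

Definition fps0 := FPS (fun=> 0).
Definition fps_opp (f : fps) := FPS (fun n => - f n).
Definition fps_add (f g : fps) := FPS (fun n => f n + g n).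
Definition fpsC (x : R) := FPS (fun n => x *+ (n == 0)%N).
Definition fps_mul (f g : fps) :=
  FPS (fun n => \sum_(i < n.+1) f i * g (n - i)%N).
Definition fpsX := FPS (fun n => (n == 1)%N%:R).

Fact fps_addA : associative fps_add.
Proof. by move=> f g h; apply: fpsP => n /=; rewrite addrA. Qed.
Fact fps_addC : commutative fps_add.
Proof. by move=> f g; apply: fpsP => n /=; rewrite addrC. Qed.
Fact fps_add0 : left_id fps0 fps_add.
Proof. by move=> f; apply: fpsP => n /=; rewrite add0r. Qed.
Fact fps_addN : left_inverse fps0 fps_opp fps_add.
Proof. by move=> f; apply: fpsP => n /=; rewrite addNr. Qed.

HB.instance Definition _ :=
  GRing.isZmodule.Build fps fps_addA fps_addC fps_add0 fps_addN.

Definition fps_trunc n (f : fps) : {poly R} := \poly_(i < n.+1) f i.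

Lemma coef_fps_trunc n (f : fps) i : (i <= n)%N -> (fps_trunc n f)`_i = f i.
Proof. by move=> le_in; rewrite coef_poly ltnS le_in. Qed.

Lemma fps_mulE n (f g : fps) (p r : {poly R}) :
  (forall i, (i <= n)%N -> p`_i = f i) ->
  (forall i, (i <= n)%N -> r`_i = g i) ->
  fps_mul f g n = (p * r)`_n.
Proof.
move=> pf rg; rewrite coefM; apply: eq_bigr => i _.
by rewrite pf ?rg ?leq_subr // -ltnS.
Qed.

Lemma fps_mul_trunc n (f g : fps) i : (i <= n)%N ->
  (fps_trunc n f * fps_trunc n g)`_i = fps_mul f g i.
Proof.
move=> le_in; rewrite (@fps_mulE i f g (fps_trunc n f) (fps_trunc n g)) //.
  by move=> j le_ji; rewrite coef_fps_trunc // (leq_trans le_ji).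
by move=> j le_ji; rewrite coef_fps_trunc // (leq_trans le_ji).
Qed.

Fact fps_mulA : associative fps_mul.
Proof.
move=> f g h; apply: fpsP => n.
rewrite (@fps_mulE n f _ (fps_trunc n f) (fps_trunc n g * fps_trunc n h));
  [|by move=> *; apply: coef_fps_trunc|by move=> *; apply: fps_mul_trunc].
rewrite (@fps_mulE n _ h (fps_trunc n f * fps_trunc n g) (fps_trunc n h));
  [|by move=> *; apply: fps_mul_trunc|by move=> *; apply: coef_fps_trunc].
by rewrite mulrA.
Qed.

Fact fps_mulC : commutative fps_mul.
Proof.
by move=> f g; apply: fpsP => n; rewrite -!(@fps_mul_trunc n) // mulrC.
Qed.

Fact fps_mul1 : left_id (fpsC 1) fps_mul.
Proof.
move=> f; apply: fpsP => n /=; rewrite big_ord_recl /= subn0 mul1r.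
by rewrite big1 ?addr0 // => i _; rewrite mul0r.
Qed.

Fact fps_mulDl : left_distributive fps_mul fps_add.
Proof.
move=> f g h; apply: fpsP => n /=; rewrite -big_split /=.
by apply: eq_bigr => i _; rewrite mulrDl.
Qed.

Fact fps_oner_neq0 : fpsC 1 != 0.
Proof.
apply/eqP => /(congr1 (fun f : fps => f 0%N)) /= /eqP.
by rewrite oner_eq0.
Qed.

HB.instance Definition _ := GRing.Zmodule_isComNzRing.Build fps
  fps_mulA fps_mulC fps_mul1 fps_mulDl fps_oner_neq0.

End Fps.

Section FpsUnit.
Variable R : comUnitRingType.
Implicit Types f g : fps R.

Definition fps_unit : pred (fps R) := fun f => f 0%N \is a GRing.unit.

(* The coefficients 0, ..., n of f^-1, from the recurrence                    *)
(* f_0 g_n = - \sum_(i < n) g_i f_(n - i).                                    *)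
Fixpoint fps_inv_tab f (n : nat) : seq R :=
  if n is m.+1 then
    let s := fps_inv_tab f m in
    rcons s (- (f 0%N)^-1 * \sum_(i < n) s`_i * f (n - i)%N)
  else [:: (f 0%N)^-1].

Definition fps_inv f : fps R :=
  if fps_unit f then FPS (fun n => (fps_inv_tab f n)`_n) else f.

Lemma size_fps_inv_tab f n : size (fps_inv_tab f n) = n.+1.
Proof. by elim: n => //= n IHn; rewrite size_rcons IHn. Qed.

Lemma nth_fps_inv_tab f n i : (i <= n)%N ->
  (fps_inv_tab f n)`_i = (fps_inv_tab f i)`_i.
Proof.
elim: n => [|n IHn]; first by rewrite leqn0 => /eqP ->.
rewrite leq_eqVlt => /orP[/eqP -> //|lt_in].
by rewrite [fps_inv_tab f n.+1]/= nth_rcons size_fps_inv_tab lt_in IHn.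
Qed.

Fact fps_mulVr : {in fps_unit, left_inverse 1 fps_inv *%R}.
Proof.
move=> f fU; rewrite /fps_inv.
have {}fU : fps_unit f by []; rewrite fU.
apply: fpsP => -[|n].
  by rewrite /= big_ord1 /= mulVr.
rewrite [LHS]/= big_ord_recr /= subnn.
rewrite nth_rcons size_fps_inv_tab ltnn eqxx mulNr mulNr mulrAC mulVr // mul1r.
apply/eqP; rewrite subr_eq0; apply/eqP; apply: eq_bigr => i _.
by rewrite (@nth_fps_inv_tab f n i) // -ltnS.
Qed.

Fact fps_unitP f g : g * f = 1 -> fps_unit f.
Proof.
move=> /(congr1 (fun h : fps R => h 0%N)) /=; rewrite big_ord1 /= => gf1.
by apply/unitrP; exists (g 0%N); split; last rewrite mulrC.
Qed.

Fact fps_inv_out : {in [predC fps_unit], fps_inv =1 id}.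
Proof.
move=> f; rewrite inE => fU; rewrite /fps_inv ifN //.
Qed.

HB.instance Definition _ := GRing.ComNzRing_hasMulInverse.Build (fps R)
  fps_mulVr fps_unitP fps_inv_out.

End FpsUnit.

Inductive colour := Ca | Cb | Cc | Cd.

Definition colour_rank (x : colour) : nat :=
  match x with Ca => 0 | Cb => 1 | Cc => 2 | Cd => 3 end.
Definition colour_ord (x : colour) : 'I_4 := inord (colour_rank x).
Definition ord_colour (i : 'I_4) : colour := nth Ca [:: Ca; Cb; Cc; Cd] i.
Fact colour_ordK : cancel colour_ord ord_colour.
Proof. by case; rewrite /colour_ord /ord_colour inordK. Qed.

HB.instance Definition _ := Finite.copy colour (can_type colour_ordK).

Definition cint : Type := (nat * colour)%type.

Definition cint_le (u v : cint) : bool :=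
  (u.1 < v.1)%N || (u.1 == v.1) && (colour_rank u.2 <= colour_rank v.2)%N.

Definition diffP (x y : colour) : nat :=
  match x, y with
  | Ca, Ca => 2 | Ca, Cb => 1 | Ca, Cc => 2 | Ca, Cd => 2
  | Cb, Ca => 1 | Cb, Cb => 0 | Cb, Cc => 1 | Cb, Cd => 1
  | Cc, Ca => 0 | Cc, Cb => 1 | Cc, Cc => 0 | Cc, Cd => 2
  | Cd, Ca => 0 | Cd, Cb => 1 | Cd, Cc => 0 | Cd, Cd => 2
  end.

(* m - m' >= P(x, y), written without truncated subtraction. *)
Definition gapP (u v : cint) : bool := (v.1 + diffP u.2 v.2 <= u.1)%N.

Definition in_calP (s : seq cint) : bool :=
  [&& all (fun u => 0 < u.1)%N s,
      sorted (fun u v => cint_le v u) s & sorted gapP s].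

Definition weight (s : seq cint) : nat := \sum_(u <- s) u.1.

Definition ncol (x : colour) (s : seq cint) : nat :=
  count (fun u : cint => u.2 == x) s.

Definition calP_le (k n : nat) : set (seq cint) :=
  [set s | [/\ in_calP s, all (fun u => u.1 <= k)%N s & weight s = n]].

(* Hence the sums over calP_le k n in GP below are genuine finite sums: the   *)
(* notation \sum_(s \in A) returns 0 when the support is infinite.            *)
Lemma finite_calP_le k n : finite_set (calP_le k n).
Proof.
pose emb (t : {bseq n of ('I_n.+1 * colour)}) : seq cint :=
  [seq (nat_of_ord u.1, u.2) | u <- (t : seq _)].
apply: (@sub_finite_set _ _ (range emb)); last first.
  by apply: finite_image; apply: finite_finset.
move=> s [/and3P[s_gt0 _ _] _ s_n] /=.
have le_n : all (fun u : cint => u.1 <= n)%N s.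
  apply/allP => u us; rewrite -s_n /weight (perm_big _ (perm_to_rem us)).
  by rewrite big_cons leq_addr.
have le_size : (size s <= n)%N.
  rewrite -s_n /weight {s_n le_n}; elim: s s_gt0 => //= u s IHs.
  by move=> /andP[u0 /IHs le_s]; rewrite big_cons -add1n leq_add.
pose t := [seq (inord u.1 : 'I_n.+1, u.2) | u <- s].
have tP : (size t <= n)%N by rewrite size_map.
exists (Bseq tP) => //; rewrite /emb /= -map_comp map_id_in // => u us /=.
by rewrite inordK ?ltnS ?(allP le_n) //; case: u {us}.
Qed.

Definition GP (R : comNzRingType) (k : nat) (a b c d : R) : fps R :=
  FPS (fun n => \sum_(s \in calP_le k n)
    a ^+ ncol Ca s * b ^+ ncol Cb s * c ^+ ncol Cc s * d ^+ ncol Cd s).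

Definition qpoch (A : comNzRingType) (x q : A) (n : nat) : A :=
  \prod_(i < n) (1 - x * q ^+ i).

Section U.
Variables (R : comUnitRingType) (a b c d : R).
Local Notation q := (fpsX R).
Local Notation "x %:S" := (fpsC x) (at level 2, format "x %:S").

(* All denominators are invertible power series as soon as 1 - b is a unit.   *)
Definition u_even (n : nat) : fps R :=
  (1 - b%:S) * \sum_(l < n.+1)
    (qpoch (- a%:S * q ^+ (2 * l + 1)) (q ^+ 2) (n - l) *
     qpoch (- d%:S * q ^+ (2 * l + 1)) (q ^+ 2) (n - l)) /
    (qpoch (b%:S * q ^+ (2 * l)) (q ^+ 2) (n - l + 1) *
     qpoch (c%:S * q ^+ (2 * l + 1)) (q ^+ 2) (n - l)) *
    (q ^+ (2 * l) / qpoch q q (2 * l)).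

Definition u_odd (n : nat) : fps R :=
  (b%:S - 1) * \sum_(l < n.+1)
    (qpoch (- a%:S * q ^+ (2 * l + 2)) (q ^+ 2) (n - l) *
     qpoch (- d%:S * q ^+ (2 * l + 2)) (q ^+ 2) (n - l)) /
    (qpoch (b%:S * q ^+ (2 * l + 1)) (q ^+ 2) (n - l + 1) *
     qpoch (c%:S * q ^+ (2 * l + 2)) (q ^+ 2) (n - l)) *
    (q ^+ (2 * l + 1) / qpoch q q (2 * l + 1)).

Definition u (j : nat) : fps R := if odd j then u_odd j./2 else u_even j./2.

End U.

(* The field Q(a, b, c, d) of rational functions in the colour variables. *)
Definition colfield : fieldType := {fraction {mpoly rat[4]}}.

Definition colvar (x : colour) : colfield :=
  tofrac ('X_(colour_ord x) : {mpoly rat[4]}).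

(* Main.v *)
Require Import Defs.
From mathcomp Require Import all_boot all_order all_algebra.
From mathcomp Require Import boolp classical_sets functions cardinality fsbigop.
From mathcomp Require Import mpoly.
From mathcomp Require Import ring zify.

(* Write G_k = (1 - b q^(k+1)) g_k. Removing the largest part, and using
   P(c, .) = P(d, .), gives for f_m = g_(m-1) the recurrence calP_rec.
   On the other side, let U(x) = \sum_j u_j x^j and
   E(x) = \sum_n q^C(n,2) x^n / (q;q)_n, so that E(x) = (1 + x) E(qx); the
   statement is that U(x) E(x) = \sum_m f_m x^m. Peeling off the last term of
   the sum u_j gives an inhomogeneous two-step recurrence, i.e. a q-difference
   equation for U whose inhomogeneous part is a combination of dilations of
   1 / E(qx). Multiplying it by E(x) and dividing by 1 + x gives a
   q-difference equation for U E, which is calP_rec again. *)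

Set Implicit Arguments.
Unset Strict Implicit.
Unset Printing Implicit Defensive.

Import GRing.Theory.
Local Open Scope ring_scope.

(** Applied repeatedly, it subtracts chosen multiples of known equations from the goal until a
    polynomial identity is left for [ring]. *)
Lemma eq_lincomb (A : comNzRingType) (k u v x y : A) :
  u = v -> x - y = k * (u - v) -> x = y.
Proof. by move=> -> /eqP; rewrite subrr mulr0 subr_eq0 => /eqP. Qed.
Arguments eq_lincomb {A} k {u v x y}.

(** * Coefficients and dilations of power series *)

Section FpsCoef.
Variable R : comNzRingType.
Implicit Types (x : R) (f g : fps R).

Lemma coef_fpsD f g n : (f + g) n = f n + g n. Proof. by []. Qed.
Lemma coef_fpsN f n : (- f) n = - f n. Proof. by []. Qed.
Lemma coef_fpsM f g n : (f * g) n = \sum_(i < n.+1) f i * g (n - i)%N.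
Proof. by []. Qed.
Lemma coef_fpsM0 f g : (f * g) 0%N = f 0%N * g 0%N.
Proof. by rewrite coef_fpsM big_ord1. Qed.
Lemma coef_fpsC x n : (fpsC x : fps R) n = x *+ (n == 0)%N. Proof. by []. Qed.
Lemma coef_fps1 n : (1 : fps R) n = (n == 0)%N%:R. Proof. by []. Qed.

Lemma coef_fpsCM x f n : (fpsC x * f) n = x * f n.
Proof.
rewrite coef_fpsM big_ord_recl /= subn0 big1 ?addr0 // => i _.
by rewrite mul0r.
Qed.

Lemma coef_fpsXM f n : (fpsX R * f) n = if n is m.+1 then f m else 0.
Proof.
rewrite coef_fpsM big_ord_recl /= mul0r add0r.
case: n => [|n]; first by rewrite big_ord0.
rewrite big_ord_recl /= mul1r subSS subn0 big1 ?addr0 // => i _.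
by rewrite mul0r.
Qed.

Lemma fpsX_inj : injective ( *%R (fpsX R)).
Proof.
move=> f g eq_fg; apply: fpsP => n.
by have := congr1 (fun h : fps R => h n.+1) eq_fg; rewrite !coef_fpsXM.
Qed.

(* The dilation f(x) |-> f(z x). *)
Definition fps_dil (z : R) f : fps R := FPS (fun n => z ^+ n * f n).

Lemma coef_fps_dil z f n : fps_dil z f n = z ^+ n * f n. Proof. by []. Qed.

Definition fps_coefE := (coef_fpsD, coef_fpsN, coef_fpsCM, coef_fpsXM,
  coef_fps_dil, coef_fpsC, coef_fps1).

Lemma fps_dilM z f g : fps_dil z (f * g) = fps_dil z f * fps_dil z g.
Proof.
apply: fpsP => n; rewrite coef_fpsM /= big_distrr /=.
apply: eq_bigr => i _.
rewrite -{1}(subnKC (leq_ord i)) exprD; ring.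
Qed.

Lemma fps_dil1 z : fps_dil z 1 = 1.
Proof. by apply: fpsP => -[|n]; rewrite /= ?mulr0 ?expr0 ?mul1r. Qed.

Lemma fps_dilD z f g : fps_dil z (f + g) = fps_dil z f + fps_dil z g.
Proof. by apply: fpsP => n; rewrite /= mulrDr. Qed.

Lemma fps_dilXM z f :
  fps_dil z (fpsX R * f) = fpsC z * (fpsX R * fps_dil z f).
Proof.
apply: fpsP => -[|n]; rewrite coef_fpsCM coef_fps_dil !coef_fpsXM ?mulr0 //.
by rewrite coef_fps_dil exprS mulrA.
Qed.

End FpsCoef.

Section FpsUnitTheory.
Variable R : comUnitRingType.
Local Notation q := (fpsX R).

Lemma fps_unitE (f : fps R) : (f \is a GRing.unit) = (f 0%N \is a GRing.unit).
Proof. by []. Qed.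

Lemma fps_unit_1BCX (x : R) n : (0 < n)%N || (1 - x \is a GRing.unit) ->
  1 - fpsC x * q ^+ n \is a GRing.unit.
Proof.
rewrite fps_unitE coef_fpsD coef_fpsN coef_fpsCM coef_fps1.
case: n => [|n]; first by rewrite expr0 coef_fps1 eqxx mulr1.
by rewrite exprS coef_fpsXM mulr0 subr0 unitr1.
Qed.

Lemma fps_unit_1BX n : 1 - q ^+ n.+1 \is a GRing.unit.
Proof.
have /= := @fps_unit_1BCX 1 n.+1 isT.
by rewrite -[fpsC 1]/(1 : fps R) mul1r.
Qed.

End FpsUnitTheory.

(** * q-Pochhammer symbols and the two-step recurrence of the sums *)

Section Qpoch.
Variable A : comNzRingType.

Lemma qpoch0 (x z : A) : qpoch x z 0 = 1.
Proof. exact: big_ord0. Qed.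

Lemma qpochSr (x z : A) n : qpoch x z n.+1 = qpoch x z n * (1 - x * z ^+ n).
Proof. exact: big_ord_recr. Qed.

End Qpoch.

Section USum.
Variables (A : comUnitRingType) (a b c d q : A).

(** The parameter [p] is the parity: 0 gives the sum in [u_even], 1 the one in [u_odd], so both are
    treated at once. *)
Definition u_sum p n : A :=
  \sum_(l < n.+1)
    (qpoch (- a * q ^+ (2 * l + p + 1)) (q ^+ 2) (n - l) *
     qpoch (- d * q ^+ (2 * l + p + 1)) (q ^+ 2) (n - l)) /
    (qpoch (b * q ^+ (2 * l + p)) (q ^+ 2) (n - l + 1) *
     qpoch (c * q ^+ (2 * l + p + 1)) (q ^+ 2) (n - l)) *
    (q ^+ (2 * l + p) / qpoch q q (2 * l + p)).

Hypothesis bU : forall i, 1 - b * q ^+ i \is a GRing.unit.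
Hypothesis cU : forall i, 1 - c * q ^+ i.+1 \is a GRing.unit.

Lemma qpoch_unit (x : A) i j n :
    (forall k, 1 - x * q ^+ (i + k) \is a GRing.unit) ->
  qpoch (x * q ^+ i) (q ^+ j) n \is a GRing.unit.
Proof.
move=> xU; elim: n => [|n IHn]; first by rewrite qpoch0 unitr1.
by rewrite qpochSr unitrM IHn /= -mulrA -exprM -exprD xU.
Qed.

(** From [n] to [n + 1] each Pochhammer symbol gains one last factor, and that factor does not
    depend on [l]; it therefore comes out of the sum. The new term [l = n + 1] has only one
    nontrivial Pochhammer factor, in [b], and gives the inhomogeneous part. *)
Lemma u_sumS p n :
  (1 - b * q ^+ (2 * n.+1 + p)) * (1 - c * q ^+ (2 * n + p + 1)) *
    u_sum p n.+1 =
  (1 + a * q ^+ (2 * n + p + 1)) * (1 + d * q ^+ (2 * n + p + 1)) *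
    u_sum p n +
  (1 - c * q ^+ (2 * n + p + 1)) *
    (q ^+ (2 * n.+1 + p) / qpoch q q (2 * n.+1 + p)).
Proof.
rewrite {1}/u_sum big_ord_recr /= subnn !qpoch0 add0n !qpochSr !qpoch0 /=.
rewrite expr0 !mulr1 !mul1r mulrDr; congr (_ + _); last first.
  by rewrite mulrA; congr (_ * _); rewrite mulrAC divrr // mul1r.
rewrite /u_sum !big_distrr /=; apply: eq_bigr => l _.
have le_ln : (l <= n)%N by rewrite -ltnS.
rewrite subSn // !addn1 !qpochSr -!mulrA -!exprM -!exprD.
have -> : (2 * l + p + 2 * (n - l).+1 = 2 * n.+1 + p)%N by lia.
have -> : ((2 * l + p).+1 + 2 * (n - l) = (2 * n + p).+1)%N by lia.
have := @qpoch_unit b _ 2 (n - l) (fun k => bU (2 * l + p + k)).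
have := @qpoch_unit c (2 * l + p).+1 2 (n - l) (fun k => cU (2 * l + p + k)).
have := bU (2 * l + p + 2 * (n - l)).
have := cU (2 * n + p); have := bU (2 * n.+1 + p).
move: (1 - b * q ^+ (2 * n.+1 + p)) (1 - c * q ^+ (2 * n + p).+1).
move: (1 - b * _) (qpoch (b * _) _ _) (qpoch (c * _) _ _) (_ / qpoch q q _).
move: (qpoch (- a * _) _ _) (qpoch (- d * _) _ _) => a' d' b1 b2 c2 z b3 c1.
move=> b3U c1U b1U c2U b2U.
rewrite !invrM ?unitrM ?b1U ?b2U ?b3U ?c1U ?c2U // !mulNr !opprK.
(* [b3] and [c1] are the new denominator factors, cancelled by the factors on the left. *)
transitivity ((b3 / b3) * (c1 / c1) *
  (a' * (1 + a * q ^+ (2 * n + p).+1) * (d' * (1 + d * q ^+ (2 * n + p).+1)) *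
   (c2^-1 * (b1^-1 * b2^-1)) * z)); first by ring.
by rewrite !divrr //; ring.
Qed.

End USum.

(** * The series E(x), 1 / E(qx) and U(x) *)

Section USequence.
Variable R : comUnitRingType.
Variables a b c d : R.
Hypothesis b1 : 1 - b \is a GRing.unit.
Local Notation A := (fps R).
Local Notation q := (fpsX R).
Local Notation "x %:S" := (fpsC x) (at level 2, format "x %:S").
Local Notation X := (fpsX A).
Local Notation dil := (fps_dil q).

Lemma qpochqq_unit n : qpoch q q n \is a GRing.unit.
Proof.
elim: n => [|n IHn]; first by rewrite qpoch0 unitr1.
by rewrite qpochSr unitrM IHn /= -exprS fps_unit_1BX.
Qed.

(** By Euler, E(x) is the infinite product of the 1 + x q^i, i >= 0. *)
Definition qexp_coef n : A := q ^+ 'C(n, 2) / qpoch q q n.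
Definition qexp : fps A := FPS qexp_coef.

Lemma qpochqqV n : (qpoch q q n)^-1 = (1 - q ^+ n.+1) / qpoch q q n.+1.
Proof.
rewrite qpochSr -exprS invrM ?qpochqq_unit ?fps_unit_1BX //.
by rewrite mulrA divrr ?mul1r // fps_unit_1BX.
Qed.

Lemma qexp_dil : qexp = dil qexp + X * dil qexp.
Proof.
apply: fpsP => -[|n]; rewrite !fps_coefE /= ?addr0 ?expr0 ?mul1r //.
rewrite /qexp_coef (qpochqqV n) binS bin1 exprD; ring.
Qed.

(** Euler's expansion of 1 / E(qx); [qexpVK] confirms it. *)
Definition qexpV_coef n : A := (-1) ^+ n * q ^+ n / qpoch q q n.
Definition qexpV : fps A := FPS qexpV_coef.

Lemma qexpV_dil : dil qexpV = qexpV + fpsC q * (X * qexpV).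
Proof.
apply: fpsP => -[|n]; rewrite !fps_coefE /= ?mulr0 ?addr0 ?expr0 ?mul1r //.
by rewrite /qexpV_coef (qpochqqV n) !exprS; ring.
Qed.

(** For n > 0 invariance says (1 - q^n) f_n = 0, and 1 - q^n is a unit. *)
Lemma fps_dil_fixed (f : fps A) : dil f = f -> f = fpsC (f 0%N).
Proof.
move=> ff; apply: fpsP => -[|n]; rewrite !fps_coefE //= mulr0n.
have /= /eqP := congr1 (fun h : fps A => h n.+1) ff.
rewrite -subr_eq0 -[X in _ - X]mul1r -mulrBl -oppr_eq0 -mulNr opprB => /eqP.
by rewrite -[RHS](mulr0 (1 - q ^+ n.+1)) => /(mulrI (fps_unit_1BX _ _)).
Qed.

(** Under x -> qx the first factor gains 1 + qx and the second loses it, so the product is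
    constant. *)
Lemma qexpVK : qexpV * dil qexp = 1.
Proof.
rewrite (@fps_dil_fixed (qexpV * dil qexp)).
  rewrite coef_fpsM0 /= /qexpV_coef /qexp_coef !expr0 !mul1r !qpoch0.
  by rewrite invr1 mulr1.
rewrite fps_dilM qexpV_dil {2}qexp_dil fps_dilD fps_dilXM; ring.
Qed.

Definition u_series : fps A := FPS (u a b c d).

Lemma u_sumE p n : (p < 2)%N ->
  u a b c d (2 * n + p) =
  (-1) ^+ p * (1 - b%:S) * u_sum a%:S b%:S c%:S d%:S q p n.
Proof.
case: p => [|[|//]] _; rewrite /u mul2n ?addn0 ?addn1 /= odd_double /=.
  rewrite /u_even doubleK expr0 mul1r; congr (_ * _); apply: eq_bigr => l _.
  by rewrite !addn0.
rewrite /u_odd uphalf_double expr1 mulN1r opprB.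
by apply: (congr1 ( *%R _)); apply: eq_bigr => l _; rewrite -!addnA.
Qed.

Lemma u0 : u a b c d 0 = 1.
Proof.
rewrite -[0%N]/(2 * 0 + 0)%N u_sumE // /u_sum big_ord1 /= !qpochSr !qpoch0.
rewrite !expr0 !mul1r !mulr1 invr1 mulr1 divrr //.
Qed.

Lemma u1 : (1 - b%:S * q) * u a b c d 1 = (1 - b%:S) * qexpV_coef 1.
Proof.
rewrite -[X in u _ _ _ _ X]/(2 * 0 + 1)%N u_sumE // /u_sum big_ord1 /=.
rewrite !qpochSr !qpoch0 /qexpV_coef qpochSr qpoch0 !expr1 !expr0 !mul1r !mulr1.
rewrite mulrCA [_ * (_^-1 * _)]mulrA divrr; first by ring.
by rewrite -[X in b%:S * X]expr1 fps_unit_1BCX.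
Qed.

(** This is [u_sumS] for both parities; the sign (-1)^p from [u_sumE] turns the inhomogeneous term
    into a coefficient of 1 / E(qx). *)
Lemma uSS j :
  (1 - b%:S * q ^+ j.+2) * (1 - c%:S * q ^+ j.+1) * u a b c d j.+2 =
  (1 + a%:S * q ^+ j.+1) * (1 + d%:S * q ^+ j.+1) * u a b c d j +
  (1 - b%:S) * (1 - c%:S * q ^+ j.+1) * qexpV_coef j.+2.
Proof.
have -> : j = (2 * j./2 + odd j)%N by rewrite addnC mul2n odd_double_half.
set n := j./2; set p := nat_of_bool _.
have p2 : (p < 2)%N by rewrite /p; case: odd.
have -> : (2 * n + p).+2 = (2 * n.+1 + p)%N by lia.
have bU i : 1 - b%:S * q ^+ i \is a GRing.unit.
  by rewrite fps_unit_1BCX // b1 orbT.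
have cU i : 1 - c%:S * q ^+ i.+1 \is a GRing.unit by apply: fps_unit_1BCX.
have := u_sumS a%:S d%:S bU cU p n; rewrite !addn1 => eqS.
rewrite !u_sumE // mulrCA eqS.
rewrite /qexpV_coef [in (-1) ^+ (_ + p)]exprD exprM sqrrN !expr1n mul1r; ring.
Qed.

(* Stated with an extra factor q, since c / q is not a power series in q. *)
Lemma u_series_dil (U0 := u_series) (U1 := dil U0) (U2 := dil U1) :
  fpsC q * U0 - fpsC b%:S * (fpsC q * U1) - fpsC c%:S * U1
    + fpsC b%:S * (fpsC c%:S * U2) =
  X * (X * (fpsC q * (U0 + fpsC a%:S * (fpsC q * U1)
    + fpsC d%:S * (fpsC q * U1)
    + fpsC a%:S * (fpsC d%:S * (fpsC q * (fpsC q * U2))))))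
  + (fpsC q * qexpV - fpsC c%:S * dil qexpV
    - fpsC b%:S * (fpsC q * qexpV - fpsC c%:S * dil qexpV)).
Proof.
rewrite /U2 /U1 /U0; apply: fpsP => -[|[|j]]; rewrite !fps_coefE /=.
- rewrite u0 /qexpV_coef !expr0 qpoch0 invr1; ring.
(* [u1] is the case j = -1 of [uSS], with u_(-1) = 0, after division by 1 - c; hence this
   multiplier. *)
- apply: (eq_lincomb (q * (1 - c%:S)) u1); rewrite !expr1.
  by move: (u _ _ _ _ _) (qexpV_coef _) => x y; ring.
- apply: (eq_lincomb q (uSS j)); rewrite !exprS.
  by move: (u _ _ _ _ j.+2) (qexpV_coef _) => x y; ring.
Qed.

End USequence.

(** * The recurrence, and the q-difference equation of U(x) E(x) *)

Section QDifference.
Variable R : comUnitRingType.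
Variables a b c d : R.
Hypothesis b1 : 1 - b \is a GRing.unit.
Local Notation A := (fps R).
Local Notation q := (fpsX R).
Local Notation "x %:S" := (fpsC x) (at level 2, format "x %:S").
Local Notation X := (fpsX A).
Local Notation dil := (fps_dil q).

(** The value 0 in the last term stands for f_(-1), so that one formula covers [i = 0]. *)
Definition calP_rec (f : nat -> A) : Prop :=
  [/\ f 0%N = 1, (1 - b%:S * q) * f 1%N = 1 &
   forall i,
    (1 - c%:S * q ^+ i.+1) * (1 - b%:S * q ^+ i.+2) * f i.+2 =
    (1 - b%:S * c%:S * q ^+ (2 * i.+1)) * f i.+1 +
    ((a%:S + d%:S) * q ^+ i.+1 + a%:S * d%:S * q ^+ (2 * i.+1)) * f i +
    a%:S * d%:S * q ^+ (2 * i).+1 * (if i is j.+1 then f j else 0)].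

(** The leading factors have constant term 1, hence are units. The recurrence looks back three
    steps, so three consecutive values are carried along. *)
Lemma calP_rec_uniq f g : calP_rec f -> calP_rec g -> f =1 g.
Proof.
move=> [f0 f1 fS] [g0 g1 gS].
suff fg n : [/\ f n = g n, f n.+1 = g n.+1 & f n.+2 = g n.+2].
  by move=> n; case: (fg n).
have bU i : 1 - b%:S * q ^+ i.+1 \is a GRing.unit by apply: fps_unit_1BCX.
have cU i : 1 - c%:S * q ^+ i.+1 \is a GRing.unit by apply: fps_unit_1BCX.
have step i : f i = g i -> f i.+1 = g i.+1 ->
    (if i is j.+1 then f j else 0) = (if i is j.+1 then g j else 0) ->
    f i.+2 = g i.+2.
  move=> e0 e1 e2; apply: (mulrI (cU i)); apply: (mulrI (bU i.+1)).
  by rewrite !(mulrA (1 - b%:S * _)) ![_ * (1 - c%:S * _)]mulrC fS gS e0 e1 e2.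
elim: n => [|n [e0 e1 e2]]; last by split=> //; apply: step.
have e0 : f 0%N = g 0%N by rewrite f0 g0.
have e1 : f 1%N = g 1%N.
  by apply: (mulrI (bU 0%N)); rewrite expr1 f1 g1.
by split=> //; apply: step.
Qed.

(** Since E(x) = (1 + x)(1 + qx) E(q^2 x), multiplication by E(x) turns 1 / E(qx) and 1 / E(q^2 x)
    into 1 + x and (1 + x)(1 + qx). The total coefficient of [F0] is q (1 - x^2), so 1 + x divides
    every term. *)
Lemma u_qexp_dil (F0 := u_series a b c d * qexp R)
    (F1 := dil F0) (F2 := dil F1) :
  fpsC q * F0 - fpsC b%:S * (fpsC q * F1) - fpsC c%:S * F1
    + fpsC b%:S * (fpsC c%:S * F2) =
  fpsC q * (X * F0) - fpsC b%:S * (fpsC c%:S * (fpsC q * (X * F2)))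
  + fpsC q * (fpsC q * (X * (X * (fpsC a%:S * F1 + fpsC d%:S * F1
      + fpsC a%:S * (fpsC d%:S * (fpsC q * (F2 + fpsC q * (X * F2))))))))
  + (fpsC q * 1 - fpsC c%:S * 1 - fpsC c%:S * (fpsC q * (X * 1))
     - fpsC b%:S *
         (fpsC q * 1 - fpsC c%:S * 1 - fpsC c%:S * (fpsC q * (X * 1)))).
Proof.
have X1U : 1 + X \is a GRing.unit.
  by rewrite fps_unitE coef_fpsD coef_fps1 -[X]mulr1 coef_fpsXM addr0 unitr1.
apply: (mulrI X1U).
rewrite /F2 /F1 /F0 !fps_dilM; move: (u_series_dil a c d b1); cbv zeta.
have := congr1 dil (qexpVK R); rewrite fps_dilM fps_dil1.
have := qexpVK R; have := qexp_dil R; have := congr1 dil (qexp_dil R).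
rewrite [in X in X -> _]fps_dilD fps_dilXM.
move: (dil (dil (qexp R))) => E2; move: (dil (qexp R)) => E1.
move: (qexp R) => E0; move: (dil (qexpV R)) => V1; move: (qexpV R) => V0.
move: (dil (dil _)) => U2; move: (dil _) => U1; move: (u_series _ _ _ _) => U0.
move=> -> ->; rewrite mulrDr => V0E V1E eqU.
(* This multiplier is E(x) expressed through E(q^2 x). *)
apply: (eq_lincomb (E2 * (1 + X) * (1 + fpsC q * X)) eqU).
apply: (eq_lincomb ((1 - fpsC b%:S) * fpsC q * (1 + X)) V0E).
apply: (eq_lincomb
  (- (1 - fpsC b%:S) * fpsC c%:S * (1 + X) * (1 + fpsC q * X)) V1E).
move: (fpsC a%:S) (fpsC b%:S) (fpsC c%:S) (fpsC d%:S) (fpsC q) X.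
by move=> a' b' c' d' q' x {V0E V1E eqU X1U}; ring.
Qed.

Lemma u_qexp_rec : calP_rec (u_series a b c d * qexp R : fps A).
Proof.
set F : fps A := _ * _; split.
- by rewrite coef_fpsM0 /= u0 // /qexp_coef qpoch0 invr1 !mulr1.
- rewrite coef_fpsM !big_ord_recr big_ord0 /= add0r u0 //.
  rewrite mulrDr (mulrA _ (u _ _ _ _ _)) u1 // subn0 /qexp_coef.
  rewrite /qexpV_coef qpoch0 qpochSr qpoch0.
  rewrite !expr1 !expr0 !mul1r invr1 !mulr1.
  (* The numerator is (1 - bq) - (1 - b) q. *)
  transitivity ((1 - q) / (1 - q)); first by ring.
  by rewrite divrr // -[q]expr1 fps_unit_1BX.
(* The q-difference equation carries an extra factor q, restored here before comparing coefficients
   of x^(i+2). *)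
- move=> i; apply: (@fpsX_inj R).
  have := congr1 (fun f : fps A => f i.+2) u_qexp_dil; rewrite -/F.
  move: F => F; case: i => [|i]; rewrite !fps_coefE /= => eqF.
    by apply: (eq_lincomb 1 eqF); ring.
  apply: (eq_lincomb 1 eqF); rewrite !mulnS mul2n -addnn !(exprS, exprD).
  ring.
Qed.

End QDifference.

(** * Generating functions sorted by the largest part *)

Lemma in_calP_cons u s : in_calP (u :: s) =
  [&& (0 < u.1)%N,
      (if s is v :: _ then cint_le v u && gapP u v else true) & in_calP s].
Proof.
rewrite /in_calP; case: s => [|v s] /=; first by rewrite !andbT.
case: (0 < u.1)%N; case: (cint_le v u); case: (gapP u v) => //=;
  by rewrite ?andbF.
Qed.

Lemma cint_le_trans u v t : cint_le u v -> cint_le v t -> cint_le u t.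
Proof. rewrite /cint_le; lia. Qed.

Lemma in_calP_all_le k s : in_calP s ->
  all (fun u : cint => (u.1 <= k)%N) s =
  (if s is v :: _ then (v.1 <= k)%N else true).
Proof.
case: s => [|v s] // /and3P[_ vs _] /=.
case: (leqP v.1 k) => //= vk; apply/allP => u us.
have /allP /(_ u us) : all (fun u => cint_le u v) s.
  by apply: order_path_min vs => x y z yx zy; apply: cint_le_trans zy yx.
by rewrite /cint_le; lia.
Qed.

Section GenFun.
Local Open Scope classical_set_scope.
Variables (R : comNzRingType) (w : colour -> R).
Local Notation q := (fpsX R).

Definition cmono (s : seq cint) : R := \prod_(u <- s) w u.2.

Lemma cmonoE s :
  w Ca ^+ ncol Ca s * w Cb ^+ ncol Cb s * w Cc ^+ ncol Cc s * w Cd ^+ ncol Cd s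
  = cmono s.
Proof.
elim: s => [|[m x] s IHs]; first by rewrite /cmono big_nil !expr0 !mulr1.
rewrite /cmono big_cons -/(cmono s) -IHs /ncol /=.
have colE y z : (y == z :> colour) = (colour_rank y == colour_rank z).
  by apply/eqP/eqP => [->|] //; case: y; case: z.
by rewrite !colE; case: x => /=; rewrite ?add0n ?add1n ?exprS; ring.
Qed.

Definition calP_wt n : set (seq cint) := [set s | in_calP s /\ weight s = n].

Lemma calP_wt_le k n :
  calP_le k n = calP_wt n `&` [set s | all (fun u => u.1 <= k)%N s].
Proof. by apply/seteqP; split => s /=; [case|case=> -[]]. Qed.

Lemma finite_calP_wt n : finite_set (calP_wt n).
Proof.
apply: sub_finite_set (finite_calP_le n n) => s [sP sn]; split=> //.
apply/allP => u us; rewrite -sn /weight (perm_big _ (perm_to_rem us)).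
by rewrite big_cons leq_addr.
Qed.

Definition gf (A : set (seq cint)) : fps R :=
  FPS (fun n => \sum_(s \in calP_wt n `&` A) cmono s).

Lemma gfU A B : [set s | in_calP s] `&` (A `&` B) `<=` set0 ->
  gf (A `|` B) = gf A + gf B.
Proof.
move=> AB0; apply: fpsP => n; rewrite coef_fpsD /= setIUr fsbigU0 //.
- by apply: finite_setIl; apply: finite_calP_wt.
- by apply: finite_setIl; apply: finite_calP_wt.
- by move=> s [[[sP _] As] [_ Bs]]; apply: (AB0 s).
Qed.

Lemma gf_eq A B : (forall s, in_calP s -> A s <-> B s) -> gf A = gf B.
Proof.
move=> AB; apply: fpsP => n /=; apply: eq_fsbigl.
by apply/seteqP; split => s [[sP sn] /AB Xs]; split=> //; apply: Xs.
Qed.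

Lemma gf_nil : gf [set [::]] = 1.
Proof.
apply: fpsP => n; rewrite coef_fps1 /=; case: n => [|n] /=.
  rewrite (_ : _ `&` _ = [set [::]]).
    by rewrite fsbig_set1 /cmono big_nil.
  apply/seteqP; split => s; first by case.
  by move=> ->; split=> //; split=> //; rewrite /weight big_nil.
rewrite (_ : _ `&` _ = set0) ?fsbig_set0 //.
apply/seteqP; split => // s [[_ sn] s0]; move: sn.
by rewrite s0 /weight big_nil.
Qed.

(** Prepending [u] is injective and shifts the weight by [u.1]; the condition on [A] keeps the
    results admissible. *)
Lemma gf_cons u A : (0 < u.1)%N ->
    A `<=` [set s | if s is v :: _ then cint_le v u && gapP u v else true] ->
  gf (cons u @` A) = fpsC (w u.2) * (q ^+ u.1 * gf A).
Proof.
move=> u0 Au; apply: fpsP => n; rewrite coef_fpsCM.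
have coefXnM m (f : fps R) :
    (q ^+ m * f) n = if (n < m)%N then 0 else f (n - m)%N.
  elim: m n => [|m IHm] n; first by rewrite expr0 mul1r subn0.
  by rewrite exprS -mulrA coef_fpsXM; case: n => // n; rewrite IHm.
rewrite coefXnM; case: ltnP => [nu|un].
  rewrite mulr0 /= (_ : _ `&` _ = set0) ?fsbig_set0 //.
  apply/seteqP; split => // s [[_ sn] [t _ ts]]; move: sn.
  by rewrite -ts /weight big_cons; lia.
rewrite /= full_fsbig_distrr; last first.
  by do 2!apply: finite_setIl; apply: finite_calP_wt.
rewrite (_ : _ `&` _ = cons u @` (calP_wt (n - u.1) `&` A)); last first.
  apply/seteqP; split => s.
    move=> [[sP sn] [t At tus]]; exists t => //; split=> //.
    move: sP sn; rewrite -tus in_calP_cons /weight big_cons => /and3P[_ _ tP].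
    by move=> <-; split=> //; rewrite addKn.
  move=> [t [[tP tn] At] <-]; split; last by exists t.
  split; last by rewrite /weight big_cons -/(weight t) tn subnKC.
  by rewrite in_calP_cons u0 tP andbT /=; have := Au t At; case: (t).
rewrite fsbig_image; last by move=> s t _ _ [].
by apply: eq_fsbigr => s _; rewrite /cmono big_cons.
Qed.

Definition headed (C : pred cint) : set (seq cint) :=
  [set s | if s is v :: _ then C v else false].

Definition hgf C : fps R := gf (headed C).

Lemma hgf_eq C D : (forall v, (0 < v.1)%N -> C v = D v) -> hgf C = hgf D.
Proof.
move=> CD; apply: gf_eq => -[|v s] //=.
by rewrite in_calP_cons => /and3P[v0 _ _]; rewrite CD.
Qed.

Lemma hgfU C D : (forall v, (0 < v.1)%N -> ~~ (C v && D v)) ->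
  hgf (fun v => C v || D v) = hgf C + hgf D.
Proof.
move=> CD; rewrite /hgf -gfU.
  by apply: gf_eq => -[|v s] _ /=; [split=> // -[]|split=> /orP].
move=> [|v s] [/= + [Cv Dv]] //; rewrite in_calP_cons => /and3P[v0 _ _].
by have /negP[] := CD v v0; rewrite Cv Dv.
Qed.

(** Such a [C] is disjoint from itself, so [hgf C] equals its own double. *)
Lemma hgf0 C : (forall v, (0 < v.1)%N -> ~~ C v) -> hgf C = 0.
Proof.
move=> C0; have CC : hgf (fun v => C v || C v) = hgf C + hgf C.
  by apply: hgfU => v /C0 /negPf->.
apply/esym/(addrI (hgf C)); rewrite addr0 -CC.
by apply: hgf_eq => v _; rewrite orbb.
Qed.

(** Removing the largest part leaves the empty sequence, counted by 1, or a sequence whose head may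
    follow that part. *)
Lemma hgf_part k x C : (0 < k)%N ->
    (forall v : cint, C v = (v.1 == k) && (colour_rank v.2 == colour_rank x)) ->
  hgf C = fpsC (w x) * (q ^+ k *
    (1 + hgf (fun v => cint_le v (k, x) && gapP (k, x) v))).
Proof.
move=> k0 CE; rewrite -gf_nil /hgf -gfU; last by move=> [|v s] [_ []].
rewrite -(gf_cons (u := (k, x))) //; last by case=> [|v s] [|].
apply: gf_eq => -[|[m y] s] sP /=; first by split=> // -[t _].
rewrite CE /=; split=> [/andP[/eqP mk /eqP yx]|]; last first.
  by move=> [t _ [<- <- _]]; rewrite !eqxx.
have {}yx : y = x by case: y x yx {CE sP} => -[].
exists s; last by rewrite mk yx.
move: sP; rewrite in_calP_cons mk yx => /and3P[_ hs _].
by case: s hs => [|v s] hs; [left|right].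
Qed.

End GenFun.

(** * The recurrence for sequences with bounded parts *)

Section Recurrence.
Variables (R : comNzRingType) (w : colour -> R).
Local Notation q := (fpsX R).
Local Notation hgf := (hgf w).

(* For k > 0 this is G_(k-1). The empty sequence makes gf_lt 0 = 1, the value *)
(* with which the recurrences below also hold at k = 0.                       *)
Definition gf_lt k : fps R := 1 + hgf (fun v => (v.1 < k)%N).
Definition gf_head k x : fps R :=
  hgf (fun v => (v.1 == k) && (colour_rank v.2 == colour_rank x)).
Definition wS x : fps R := fpsC (w x).

Lemma GP_gf_lt k : GP k (w Ca) (w Cb) (w Cc) (w Cd) = gf_lt k.+1.
Proof.
rewrite /gf_lt -(gf_nil w) /hgf -gfU; last by move=> [|v s] [_ []].
apply: fpsP => n /=; rewrite calP_wt_le.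
have -> : (calP_wt n `&` [set s | all (fun u => u.1 <= k)%N s])%classic =
  (calP_wt n `&` ([set [::]] `|` headed (fun v => v.1 < k.+1)%N))%classic.
  apply/seteqP; split => -[|v s] [[sP sn] h]; split=> //=.
  - by left.
  - by right; move: h; rewrite /= -[_ && _]/(all _ (v :: s)) in_calP_all_le.
  - have := in_calP_all_le k sP; rewrite /= => ->; by case: h.
by apply: eq_fsbigr => s _; rewrite cmonoE.
Qed.

Ltac hd_cases := move=> [m []] /=; rewrite ?/cint_le /gapP /=; lia.

Lemma gf_lt0 : gf_lt 0 = 1.
Proof. by rewrite /gf_lt hgf0 ?addr0. Qed.

Lemma gf_head0 x : gf_head 0 x = 0.
Proof. by rewrite /gf_head hgf0 // => -[[]]. Qed.

Lemma gf_ltS k : gf_lt k.+1 =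
  gf_lt k + gf_head k Ca + gf_head k Cb + gf_head k Cc + gf_head k Cd.
Proof.
rewrite /gf_lt -!addrA; congr (1 + _); rewrite !addrA -!hgfU; try hd_cases.
apply: hgf_eq; hd_cases.
Qed.

(** P(a, b) = 1 and P(a, y) = 2 otherwise: the next value is below [k], or the next part is k_b. *)
Lemma gf_head_a k : gf_head k.+1 Ca =
  wS Ca * (q ^+ k.+1 * (gf_lt k + gf_head k Cb)).
Proof.
rewrite /gf_head (@hgf_part _ _ k.+1 Ca) // /gf_lt -addrA.
congr (_ * (_ * (1 + _))); rewrite -hgfU; last by hd_cases.
apply: hgf_eq; hd_cases.
Qed.

Lemma gf_head_b k : gf_head k.+1 Cb =
  wS Cb * (q ^+ k.+1 * (gf_lt k.+1 + gf_head k.+1 Cb)).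
Proof.
rewrite {1}/gf_head (@hgf_part _ _ k.+1 Cb) // /gf_lt -addrA.
congr (_ * (_ * (1 + _))); rewrite -hgfU; last by hd_cases.
apply: hgf_eq; hd_cases.
Qed.

(* As P(c, .) = P(d, .), this is the series of what may follow either of the  *)
(* parts (k + 1)_c and (k + 1)_d.                                             *)
Definition gf_below_c k : fps R :=
  gf_lt k + gf_head k Ca + gf_head k Cb + gf_head k Cc +
  gf_head k.+1 Ca + gf_head k.+1 Cc.

Lemma gf_head_c k : gf_head k.+1 Cc = wS Cc * (q ^+ k.+1 * gf_below_c k).
Proof.
rewrite {1}/gf_head (@hgf_part _ _ k.+1 Cc) // /gf_below_c /gf_lt -!addrA.
congr (_ * (_ * (1 + _))); rewrite !addrA -!hgfU; try hd_cases.
apply: hgf_eq; hd_cases.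
Qed.

Lemma gf_head_d k : gf_head k.+1 Cd = wS Cd * (q ^+ k.+1 * gf_below_c k).
Proof.
rewrite {1}/gf_head (@hgf_part _ _ k.+1 Cd) // /gf_below_c /gf_lt -!addrA.
congr (_ * (_ * (1 + _))); rewrite !addrA -!hgfU; try hd_cases.
apply: hgf_eq; hd_cases.
Qed.

(** As P(b, b) = 0, the quotient g_k also admits any number of parts (k + 1)_b in front; this is the
    source of the factor 1 - b q^(k+1). *)
Lemma gf_lt_head_b k :
  gf_lt k.+1 = (1 - wS Cb * q ^+ k.+1) * (gf_lt k.+1 + gf_head k.+1 Cb).
Proof. by apply: (eq_lincomb 1 (esym (gf_head_b k))); ring. Qed.

End Recurrence.

Lemma gf_lt_rec (R : comUnitRingType) (w : colour -> R) :
  calP_rec (w Ca) (w Cb) (w Cc) (w Cd)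
    (fun k => gf_lt w k + gf_head w k Cb).
Proof.
split.
- by rewrite gf_lt0 gf_head0 addr0.
- have := gf_lt_head_b w 0; rewrite expr1 => <-.
  by rewrite gf_ltS gf_lt0 !gf_head0 !addr0.
move=> i; rewrite -mulrA -gf_lt_head_b gf_ltS.
have := gf_head_d w i; have := gf_head_c w i.
have := gf_head_b w i; have := gf_head_a w i; rewrite /gf_below_c gf_ltS.
have : wS w Cc * gf_head w i Cd = wS w Cd * gf_head w i Cc.
  by case: i => [|i]; rewrite ?gf_head0 ?mulr0 // gf_head_c gf_head_d; ring.
(* What may follow i_a is counted by f_(i-1); this yields the last term of [calP_rec]. *)
have : wS w Cd * fpsX R ^+ i.+1 * gf_head w i Ca =
    wS w Ca * wS w Cd * fpsX R ^+ (2 * i).+1 *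
      (if i is j.+1 then gf_lt w j + gf_head w j Cb else 0).
  case: i => [|i]; first by rewrite gf_head0 !mulr0.
  rewrite gf_head_a !mulnS mul2n -addnn !(exprS, exprD); ring.
rewrite -!/(wS w _) [(2 * i.+1)%N]mul2n -addnn exprD.
move: (fpsX R ^+ (2 * i).+1) (fpsX R ^+ i.+1).
move=> r p eA' eD' eA eB eC eD.
(* Linear elimination of the head series, with p = q^(i+1) and r = q^(2i+1). *)
apply: (eq_lincomb (1 - wS w Cc * p) eC).
apply: (eq_lincomb (1 - wS w Cc * p) eD).
apply: (eq_lincomb ((wS w Cc + wS w Cd) * p) eC).
apply: (eq_lincomb (- p) eD').
apply: (eq_lincomb (1 + wS w Cd * p) eA).
apply: (eq_lincomb (- (wS w Cc * p)) eB).
apply: (eq_lincomb 1 eA').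
ring.
Qed.

(** * Conclusion over the field of rational functions *)

Lemma colvar_neq1 x : 1 - colvar x != 0.
Proof.
rewrite subr_eq0 eq_sym /colvar -tofrac1 tofrac_eq.
apply/eqP => /(congr1 (fun p => p@_0%MM)).
rewrite mcoeffX mcoeff1 eqxx mnm1_eq0 /= => /eqP.
by rewrite eq_sym oner_eq0.
Qed.

Theorem theorem1p11 (k : nat) (hk : (0 < k)%N) :
  let a := colvar Ca in
  let b := colvar Cb in
  let c := colvar Cc in
  let d := colvar Cd in
  let q := fpsX colfield in
  GP k a b c d =
    (1 - fpsC b * q ^+ (k + 1)) *
    \sum_(j < k + 2)
      u a b c d j * q ^+ 'C(k + 1 - j, 2) / qpoch q q (k + 1 - j).
Proof.
have b1 : 1 - colvar Cb \is a GRing.unit by rewrite unitfE colvar_neq1.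
move=> a b c d q; rewrite GP_gf_lt gf_lt_head_b addn1 addn2.
congr (_ * _).
(* What is left is f_(k+1), replaced by the coefficient of x^(k+1) in U(x) E(x), which is the
   required convolution. *)
rewrite (calP_rec_uniq (gf_lt_rec colvar) (u_qexp_rec _ _ _ b1)).
rewrite coef_fpsM; apply: eq_bigr => j _.
by rewrite mulrA.
Qed.
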